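(* Let $d\in\{1,2\}$, let $M,C$ be positive integers, let $k\geq 1$ be an odd integer, let $N\geq 2k-1$, and consider stride $S=1$. With the 'valid' boundary condition, there exists no orthogonal convolutional layer in the CO case ($M\geq C$): for every kernel tensor $\mathbf{K}$ (in $\mathbb{R}^{M\times C\times k}$ if $d=1$, in $\mathbb{R}^{M\times C\times k\times k}$ if $d=2$), the associated 'valid' layer transform matrix $\mathcal{K}$ satisfies $\mathcal{K}^T\mathcal{K}\neq \mathrm{Id}_{CN^d}$.
   Context: Kernel spatial indices run from $0$ to $k-1$. With the 'valid' boundary condition and stride $1$, only those output entries for which the translated kernel's support is entirely contained in the input domain are computed. For $d=1$, $\mathcal{K}\in\mathbb{R}^{M(N-k+1)\times CN}$ is the matrix (after vectorization) of the linear map $X\in\mathbb{R}^{C\times N}\mapsto Y\in\mathbb{R}^{M\times(N-k+1)}$, $$Y_{m,i}=\sum_{c=1}^C\sum_{i'=0}^{k-1}\mathbf{K}_{m,c,i'}X_{c,i+i'},\qquad 0\le i\le N-k.$$ For $d=2$, $\mathcal{K}\in\mathbb{R}^{M(N-k+1)^2\times CN^2}$ is the matrix of the linear map $X\in\mathbb{R}^{C\times N\times N}\mapsto Y\in\mathbb{R}^{M\times(N-k+1)\times(N-k+1)}$, $$Y_{m,i,j}=\sum_{c=1}^C\sum_{i'=0}^{k-1}\sum_{j'=0}^{k-1}\mathbf{K}_{m,c,i',j'}X_{c,i+i',j+j'},\qquad 0\le i,j\le N-k.$$ In the CO (column) case, which for stride $S=1$ is $M\geq C$, $\mathcal{K}$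 is called orthogonal if its columns are normalized and mutually orthogonal, i.e. $\mathcal{K}^T\mathcal{K}=\mathrm{Id}_{CN^d}$.
   Formalization: The kernel size is taken to be an odd integer k > 1 instead of k ≥ 1: for k = 1 the claim is false, since the kernel with entries 1 if m = c and 0 otherwise gives an orthogonal layer whenever M ≥ C. *)

(* Defs.v *)
From HB Require Import structures.
From mathcomp Require Import all_boot all_order all_algebra.
From mathcomp Require Import reals.

Set Implicit Arguments.
Unset Strict Implicit.
Unset Printing Implicit Defensive.

Import GRing.Theory.
Local Open Scope ring_scope.

Lemma size_ge_kernel (N k : nat) : (0 < k)%N -> (2 * k - 1 <= N)%N -> (k <= N)%N.
Proof. by move=> k0; apply: leq_trans; rewrite mul2n -addnn -addnBA ?leq_addr. Qed.

Lemma ltn_shift (N k : nat) (kN : (k <= N)%N) (i : 'I_(N - k + 1)) (i' : 'I_k) :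
  (i + i' < N)%N.
Proof.
have iN : (i <= N - k)%N by rewrite -ltnS -[X in (_ < X)%N]addn1.
by rewrite -(leq_add2r k) subnK // in iN; apply: leq_trans iN; rewrite ltn_add2l.
Qed.

Definition shift (N k : nat) (kN : (k <= N)%N) (i : 'I_(N - k + 1)) (i' : 'I_k)
  : 'I_N := Ordinal (ltn_shift kN i i').

Section ValidConvolution.
Variables (R : realType) (M C k N : nat) (kN : (k <= N)%N).

Definition conv1 (K : 'I_M -> 'I_C -> 'I_k -> R) (X : 'M[R]_(C, N)) :
    'M[R]_(M, N - k + 1) :=
  \matrix_(m < M, i < N - k + 1)
    \sum_(c < C) \sum_(i' < k) K m c i' * X c (shift kN i i').

(* A tensor of size C x N x N is stored as the C x (N * N) matrix whose row c  *)
(* is the vectorization of channel c: its entry (c, i, j) is                   *)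
(* X c (mxvec_index i j).                                                      *)
Definition conv2 (K : 'I_M -> 'I_C -> 'I_k -> 'I_k -> R)
    (X : 'M[R]_(C, N * N)) :
    'M[R]_(M, (N - k + 1) * (N - k + 1)) :=
  \matrix_(m < M) mxvec (\matrix_(i < N - k + 1, j < N - k + 1)
    \sum_(c < C) \sum_(i' < k) \sum_(j' < k)
      K m c i' j' * X c (mxvec_index (shift kN i i') (shift kN j j'))).

Fact conv1_is_linear K : linear (conv1 K).
Proof.
move=> a X Y; apply/matrixP => m i; rewrite !mxE mulr_sumr -big_split.
apply: eq_bigr => c _; rewrite mulr_sumr -big_split; apply: eq_bigr => i' _.
by rewrite !mxE mulrDr mulrCA.
Qed.

HB.instance Definition _ K :=
  GRing.isLinear.Build R 'M[R]_(C, N) 'M[R]_(M, N - k + 1) _ (conv1 K)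
    (conv1_is_linear K).

Fact conv2_is_linear K : linear (conv2 K).
Proof.
move=> a X Y; apply/matrixP => m p; case/mxvec_indexP: p => i j.
rewrite !mxE !mxvecE !mxE mulr_sumr -big_split.
apply: eq_bigr => c _; rewrite mulr_sumr -big_split; apply: eq_bigr => i' _.
rewrite mulr_sumr -big_split; apply: eq_bigr => j' _.
by rewrite !mxE mulrDr mulrCA.
Qed.

HB.instance Definition _ K :=
  GRing.isLinear.Build R 'M[R]_(C, N * N)
    'M[R]_(M, (N - k + 1) * (N - k + 1)) _ (conv2 K) (conv2_is_linear K).

(* lin_mx acts on row vectors from the right, hence the transposition. *)
Definition layer1 (K : 'I_M -> 'I_C -> 'I_k -> R) :
  'M[R]_(M * (N - k + 1), C * N) := (lin_mx (conv1 K))^T.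

Definition layer2 (K : 'I_M -> 'I_C -> 'I_k -> 'I_k -> R) :
    'M[R]_(M * ((N - k + 1) * (N - k + 1)), C * (N * N)) :=
  (lin_mx (conv2 K))^T.

Lemma layer1P K X : layer1 K *m (mxvec X)^T = (mxvec (conv1 K X))^T.
Proof. by rewrite -trmx_mul mul_vec_lin. Qed.

Lemma layer2P K X : layer2 K *m (mxvec X)^T = (mxvec (conv2 K X))^T.
Proof. by rewrite -trmx_mul mul_vec_lin. Qed.

End ValidConvolution.

(* For kernels of size k = 1 the layer acts pixelwise, and orthogonal layers   *)
(* do exist as soon as C <= M: nonexistence can only hold for k > 1.           *)
Section KernelSizeOne.
Variables (R : realType) (M C N : nat) (N1 : (1 <= N)%N) (CM : (C <= M)%N).

Let sizeE : (N - 1 + 1 = N)%N := subnK N1.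

Fact shift1E (i : 'I_(N - 1 + 1)) (i' : 'I_1) : shift N1 i i' = cast_ord sizeE i.
Proof. by apply: val_inj; rewrite /= ord1 addn0. Qed.

Fact orthogonal_injection n n' (h : 'I_n -> 'I_n') (A : 'M[R]_(n', n)) :
  injective h -> (forall q r, A q r = (q == h r)%:R) -> A^T *m A = 1%:M.
Proof.
move=> h_inj AE; apply/matrixP => r s; rewrite !mxE (bigD1 (h r)) //=.
rewrite mxE !AE eqxx mul1r big1 ?addr0 ?(inj_eq h_inj) // => q qNhr.
by rewrite mxE AE (negPf qNhr) mul0r.
Qed.

Lemma layer1_size1_orthogonal :
  exists K : 'I_M -> 'I_C -> 'I_1 -> R, (layer1 N1 K)^T *m layer1 N1 K = 1%:M.
Proof.
exists (fun m c _ => (m == widen_ord CM c)%:R).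
have [g gK' Kg'] := curry_mxvec_bij C N.
have gK c p : g (mxvec_index c p) = (c, p) by apply: (gK' (c, p)).
have Kg r : uncurry (@mxvec_index C N) (g r) = r by apply: Kg'.
pose h r := mxvec_index (widen_ord CM (g r).1) (cast_ord (esym sizeE) (g r).2).
have idx_inj : injective (uncurry (@mxvec_index M (N - 1 + 1))).
  have [f fK _] := curry_mxvec_bij M (N - 1 + 1).
  by move=> x y xy; rewrite -[x]fK ?inE // xy fK ?inE.
apply: (@orthogonal_injection _ _ h) => [r s hrs|q r].
  have [] := idx_inj (_, _) (_, _) hrs.
  move=> /val_inj e1 /val_inj e2; rewrite -(Kg r) -(Kg s).
  by case: (g r) (g s) e1 e2 => [? ?] [? ?] /= -> ->.
case/mxvec_indexP: q => m i; case/mxvec_indexP: r => c p.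
rewrite mxE /lin_mx /lin1_mx mxE /= mxvecE mxE.
have -> : h (mxvec_index c p) =
    mxvec_index (widen_ord CM c) (cast_ord (esym sizeE) p).
  by rewrite /h gK.
rewrite (inj_eq idx_inj (m, i) (_, _)) xpair_eqE.
rewrite (bigD1 c) //= big_ord1 shift1E big1 ?addr0 => [|c' c'c].
  rewrite vec_mx_delta mxE eqxx /= -natrM mulnb; congr (_ && _)%:R.
by rewrite big_ord1 vec_mx_delta mxE (negPf c'c) mulr0.
Qed.

End KernelSizeOne.

(* Main.v *)
(* A corner of the input domain meets the translated kernel in a single        *)
(* position, so the norm of its column is the norm of one kernel tap, the      *)
(* first or the last. Since N >= 2k - 1, the pixel of coordinates k - 1 meets  *)
(* every tap: its column would have squared norm at least 1 + 1, the first and *)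
(* last taps being distinct because k > 1.                                     *)
Require Import Defs.
From HB Require Import structures.
From mathcomp Require Import all_boot all_order all_algebra.
From mathcomp Require Import reals.
From mathcomp Require Import zify.

Set Implicit Arguments.
Unset Strict Implicit.
Unset Printing Implicit Defensive.

Import GRing.Theory Num.Theory.
Local Open Scope ring_scope.

(** Orthogonality would force every column to have squared norm 1. For a fixed input channel, the
    columns of pixels 0 and N - 1 then give the first and the last tap squared norm 1 over the
    output channels. Both taps reappear, at different output positions, in the column of pixel k -
    1, whose squared norm is thus at least 2. [corner_columns_not_orthogonal] is this clash in
    matrix form; [layer1_shift], [layer1_eq0] and their [layer2] analogues supply the entries. In
    dimension two the three pixels lie on the diagonal. *)

Lemma mxvec_index_eq m n (i i' : 'I_m) (j j' : 'I_n) :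
  (mxvec_index i j == mxvec_index i' j') = (i == i') && (j == j').
Proof. by rewrite (inj_eq (@cast_ord_inj _ _ _)) (inj_eq enum_rank_inj). Qed.

Lemma sum_mxvec_index (V : nmodType) m n (F : 'I_(m * n) -> V) :
  \sum_q F q = \sum_i \sum_j F (mxvec_index i j).
Proof.
rewrite pair_bigA /=.
rewrite (reindex (uncurry (@mxvec_index m n))); last exact: curry_mxvec_bij.
by apply: eq_bigr => -[].
Qed.

Lemma colnorm_orthogonal (R : pzRingType) m n (A : 'M[R]_(m, n)) p :
  A^T *m A = 1%:M -> \sum_q A q p ^+ 2 = 1.
Proof.
move/matrixP/(_ p p); rewrite !mxE eqxx mulr1n => <-.
by apply: eq_bigr => q _; rewrite mxE expr2.
Qed.

(** Column [p2] contains the whole support of column [p0] and that of column [p1], moved to disjoint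
    rows. The position type ['I_n] is left abstract so as to cover both one index and a vectorized
    pair. *)
Lemma corner_columns_not_orthogonal (R : realDomainType) M n r
    (A : 'M[R]_(M * n, r)) (p0 p1 p2 : 'I_r) (i0 i1 j0 j1 : 'I_n) :
    (forall m i, i != i0 -> A (mxvec_index m i) p0 = 0) ->
    (forall m i, i != i1 -> A (mxvec_index m i) p1 = 0) ->
    (forall m, A (mxvec_index m j0) p2 = A (mxvec_index m i0) p0) ->
    (forall m, A (mxvec_index m j1) p2 = A (mxvec_index m i1) p1) ->
    j1 != j0 ->
  A^T *m A <> 1%:M.
Proof.
move=> A0 A1 eq0 eq1 neq /colnorm_orthogonal AE.
have single p i : (forall m i', i' != i -> A (mxvec_index m i') p = 0) ->
    \sum_m A (mxvec_index m i) p ^+ 2 = 1.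
  move=> Ap; rewrite -(AE p) sum_mxvec_index; apply: eq_bigr => m _.
  rewrite [RHS](bigD1 i) //= [X in _ + X]big1 ?addr0 // => i' i'i.
  by rewrite Ap // expr0n.
have : 1 + 1 <= 1 :> R.
  (* Each 1 on the left becomes a corner column norm, the 1 on the right the norm of column [p2];
     the sums are compared output channel by output channel. *)
  rewrite -{1}(single _ _ A0) -{1}(single _ _ A1) -(AE p2) sum_mxvec_index.
  rewrite -big_split; apply: ler_sum => m _ /=.
  rewrite -eq0 -eq1 (bigD1 j0) //= lerD2l (bigD1 j1) //= lerDl.
  by apply: sumr_ge0 => i _; apply: sqr_ge0.
by rewrite gerDl ler10.
Qed.

Lemma shift_inj N k (kN : (k <= N)%N) i : injective (shift kN i).
Proof. by move=> a b [] /addnI /val_inj. Qed.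

Section Entries.
Variables (R : realType) (M C k N : nat) (kN : (k <= N)%N).

(** A column is the image of a basis tensor, so only channel [c] survives. *)
Lemma layer1E (K : 'I_M -> 'I_C -> 'I_k -> R) m i c p :
  layer1 kN K (mxvec_index m i) (mxvec_index c p) =
  \sum_i' K m c i' * (shift kN i i' == p)%:R.
Proof.
rewrite mxE /lin_mx /lin1_mx mxE /= mxvecE mxE vec_mx_delta.
rewrite (bigD1 c) //= [X in _ + X]big1 ?addr0 => [|c' c'c].
  by apply: eq_bigr => i' _; rewrite mxE eqxx.
by apply: big1 => i' _; rewrite mxE (negPf c'c) mulr0.
Qed.

(** For a fixed output position, distinct taps read distinct pixels, so one term of the sum
    remains. *)
Lemma layer1_shift (K : 'I_M -> 'I_C -> 'I_k -> R) m i c i' p :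
  shift kN i i' = p ->
  layer1 kN K (mxvec_index m i) (mxvec_index c p) = K m c i'.
Proof.
move=> <-; rewrite layer1E (bigD1 i') //= eqxx mulr1 big1 ?addr0 // => a ai'.
by rewrite (inj_eq (@shift_inj _ _ kN i)) (negPf ai') mulr0.
Qed.

Lemma layer1_eq0 (K : 'I_M -> 'I_C -> 'I_k -> R) m i c p :
  (forall i', shift kN i i' != p) ->
  layer1 kN K (mxvec_index m i) (mxvec_index c p) = 0.
Proof.
by move=> ip; rewrite layer1E big1 // => i' _; rewrite (negPf (ip i')) mulr0.
Qed.

Lemma layer2E (K : 'I_M -> 'I_C -> 'I_k -> 'I_k -> R) m i j c p q :
  layer2 kN K (mxvec_index m (mxvec_index i j))
    (mxvec_index c (mxvec_index p q)) =
  \sum_i' \sum_j' K m c i' j' * ((shift kN i i' == p) && (shift kN j j' == q))%:R.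
Proof.
rewrite mxE /lin_mx /lin1_mx mxE /= mxvecE mxE mxvecE mxE vec_mx_delta.
rewrite (bigD1 c) //= [X in _ + X]big1 ?addr0 => [|c' c'c].
  apply: eq_bigr => i' _; apply: eq_bigr => j' _.
  by rewrite mxE eqxx mxvec_index_eq.
by apply: big1 => i' _; apply: big1 => j' _; rewrite mxE (negPf c'c) mulr0.
Qed.

Lemma layer2_shift (K : 'I_M -> 'I_C -> 'I_k -> 'I_k -> R) m i j c i' j' p q :
  shift kN i i' = p -> shift kN j j' = q ->
  layer2 kN K (mxvec_index m (mxvec_index i j))
    (mxvec_index c (mxvec_index p q)) = K m c i' j'.
Proof.
move=> <- <-; rewrite layer2E (bigD1 i') //= [X in _ + X]big1 => [|a ai'].
  rewrite addr0 (bigD1 j') //= !eqxx mulr1 big1 ?addr0 // => b bj'.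
  by rewrite (inj_eq (@shift_inj _ _ kN j)) (negPf bj') mulr0.
apply: big1 => b _.
by rewrite (inj_eq (@shift_inj _ _ kN i)) (negPf ai') mulr0.
Qed.

Lemma layer2_eq0 (K : 'I_M -> 'I_C -> 'I_k -> 'I_k -> R) m i j c p q :
  (forall i', shift kN i i' != p) \/ (forall j', shift kN j j' != q) ->
  layer2 kN K (mxvec_index m (mxvec_index i j))
    (mxvec_index c (mxvec_index p q)) = 0.
Proof.
move=> out; rewrite layer2E big1 // => i' _; rewrite big1 // => j' _.
by case: out => /(_ _)/negPf->; rewrite ?andbF mulr0.
Qed.

End Entries.

Theorem proposition5 (R : realType) (M C k N : nat)
    (hM : (0 < M)%N) (hC : (0 < C)%N)
    (hk : (1 < k)%N) (hodd : odd k)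
    (hN : (2 * k - 1 <= N)%N)
    (hCO : (C <= M)%N) :
  let kN : (k <= N)%N := size_ge_kernel (ltnW hk) hN in
  (forall K : 'I_M -> 'I_C -> 'I_k -> R,
     (layer1 kN K)^T *m layer1 kN K <> 1%:M)
  /\
  (forall K : 'I_M -> 'I_C -> 'I_k -> 'I_k -> R,
     (layer2 kN K)^T *m layer2 kN K <> 1%:M).
Proof.
move=> kN; pose c := Ordinal hC.
have [lt_p0 lt_p1 lt_p2] : [/\ 0 < N, N - 1 < N & k - 1 < N]%N by split; lia.
(* Position k - 1 is a valid output exactly because N >= 2k - 1. *)
have [lt_i0 lt_i1 lt_j0] :
  [/\ 0 < N - k + 1, N - k < N - k + 1 & k - 1 < N - k + 1]%N by split; lia.
have [lt_t0 lt_t1] : (0 < k)%N /\ (k - 1 < k)%N by split; lia.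
(* Input pixels are named [p], output positions [i] and [j], kernel taps [t]. *)
pose p0 := Ordinal lt_p0; pose p1 := Ordinal lt_p1; pose p2 := Ordinal lt_p2.
pose i0 := Ordinal lt_i0; pose i1 := Ordinal lt_i1; pose j0 := Ordinal lt_j0.
pose t0 := Ordinal lt_t0; pose t1 := Ordinal lt_t1.
(* A sum i + i' equal to 0 forces i = 0; equal to N - 1, it forces i = N - k and i' = k - 1. *)
have out0 i : i != i0 -> forall i', shift kN i i' != p0.
  by rewrite -!val_eqE /= => ni i'; rewrite -val_eqE /=; lia.
have out1 i : i != i1 -> forall i', shift kN i i' != p1.
  move: (ltn_ord i); rewrite -!val_eqE /= => ? ni i'; rewrite -val_eqE /=.
  by move: (ltn_ord i'); lia.
have s0 : shift kN i0 t0 = p0 by apply: val_inj.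
have s1 : shift kN i1 t1 = p1 by apply: val_inj => /=; lia.
have s2 : shift kN j0 t0 = p2 by apply: val_inj => /=; lia.
have s3 : shift kN i0 t1 = p2 by apply: val_inj.
have neq : i0 != j0 by rewrite -val_eqE /=; lia.
split=> K.
  apply: (@corner_columns_not_orthogonal _ _ _ _ _ (mxvec_index c p0)
    (mxvec_index c p1) (mxvec_index c p2) i0 i1 j0 i0) => // [m i ni|m i ni|m|m].
  - exact/layer1_eq0/out0.
  - exact/layer1_eq0/out1.
  - by rewrite (layer1_shift _ _ _ s2) (layer1_shift _ _ _ s0).
  - by rewrite (layer1_shift _ _ _ s3) (layer1_shift _ _ _ s1).
(* On the diagonal, a position other than the corner one differs from it in some coordinate, and a
   miss in that coordinate makes the entry vanish. *)
pose d n (i : 'I_n) := mxvec_index i i.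
apply: (@corner_columns_not_orthogonal _ _ _ _ _ (mxvec_index c (d _ p0))
  (mxvec_index c (d _ p1)) (mxvec_index c (d _ p2))
  (d _ i0) (d _ i1) (d _ j0) (d _ i0)) => [m ij|m ij|m|m|].
- case/mxvec_indexP: ij => i j; rewrite mxvec_index_eq negb_and => /orP nij.
  by apply: layer2_eq0; case: nij => /out0; [left|right].
- case/mxvec_indexP: ij => i j; rewrite mxvec_index_eq negb_and => /orP nij.
  by apply: layer2_eq0; case: nij => /out1; [left|right].
- by rewrite (layer2_shift _ _ _ s2 s2) (layer2_shift _ _ _ s0 s0).
- by rewrite (layer2_shift _ _ _ s3 s3) (layer2_shift _ _ _ s1 s1).
- by rewrite mxvec_index_eq (negPf neq).
Qed.
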